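(* For any $\alpha\in(0,1)\setminus\{1/2\}$ and any $p,q>0$ there exist positive definite $2\times2$ matrices $A,B$ such that $\widetilde{SG}_{\alpha,p}(A,B)\not\le_{\mathrm{near}}\mathcal{A}_{\alpha,q}(A,B)$. Hence, for any $\alpha\in(0,1)$ and any $p,q>0$ there exist positive definite $2\times2$ matrices $A,B$ such that $\widetilde{SG}_{\alpha,p}(A,B)\not\le_{\mathrm{chao}}\mathcal{A}_{\alpha,q}(A,B)$.
   Context: For positive definite $A,B$: $A\#_\alpha B:=A^{1/2}(A^{-1/2}BA^{-1/2})^\alpha A^{1/2}$, $\#:=\#_{1/2}$; $\widetilde F_\alpha(A,B):=(A^{-1}\#_\alpha B)^{1/2}A^{2(1-\alpha)}(A^{-1}\#_\alpha B)^{1/2}$; $\widetilde{SG}_{\alpha,p}(A,B):=\widetilde F_\alpha(A^p,B^p)^{1/p}$; $\mathcal{A}_{\alpha,q}(A,B):=((1-\alpha)A^q+\alpha B^q)^{1/q}$. For positive definite $X,Y$: $X\le_{\mathrm{chao}}Y$ means $\log X\le\log Y$ (Loewner order); $X\le_{\mathrm{near}}Y$ means $X\#Y^{-1}\le I$. *)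

(* Defs.v *)
From HB Require Import structures.
From mathcomp Require Import all_boot all_order all_algebra.
From mathcomp Require Import boolp reals exp.
Set Implicit Arguments. Unset Strict Implicit. Unset Printing Implicit Defensive.
Import Order.TTheory GRing.Theory Num.Theory.
Local Open Scope ring_scope.

Section Defs.
Variable R : realType.

Definition posdef n (A : 'M[R]_n) : Prop :=
  A^T = A /\ forall v : 'rV[R]_n, v != 0 -> 0 < (v *m A *m v^T) 0 0.

Definition psd n (A : 'M[R]_n) : Prop :=
  A^T = A /\ forall v : 'rV[R]_n, 0 <= (v *m A *m v^T) 0 0.

Definition loewner_le n (X Y : 'M[R]_n) : Prop := psd (Y - X).

Definition spec_decomp n (A U : 'M[R]_n) (d : 'rV[R]_n) : Prop :=
  U *m U^T = 1%:M /\ A = U *m diag_mx d *m U^T.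

(* functional calculus f(A) for a symmetric matrix A (0 if A is not
   orthogonally diagonalizable) *)
Definition mfun n (f : R -> R) (A : 'M[R]_n) : 'M[R]_n :=
  match pselect (exists Ud : 'M[R]_n * 'rV[R]_n, spec_decomp A Ud.1 Ud.2) with
  | left H => let Ud := projT1 (cid H) in
              Ud.1 *m diag_mx (map_mx f Ud.2) *m Ud.1^T
  | right _ => 0
  end.

Definition mpow n (A : 'M[R]_n) (t : R) : 'M[R]_n := mfun (fun x => x `^ t) A.
Definition mlog n (A : 'M[R]_n) : 'M[R]_n := mfun (@ln R) A.

Definition gmean n (a : R) (A B : 'M[R]_n) : 'M[R]_n :=
  mpow A (2^-1) *m mpow (mpow A (- 2^-1) *m B *m mpow A (- 2^-1)) a
    *m mpow A (2^-1).

Definition Ftilde n (a : R) (A B : 'M[R]_n) : 'M[R]_n :=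
  let G := gmean a (invmx A) B in
  mpow G (2^-1) *m mpow A (2 * (1 - a)) *m mpow G (2^-1).

Definition SGtilde n (a p : R) (A B : 'M[R]_n) : 'M[R]_n :=
  mpow (Ftilde a (mpow A p) (mpow B p)) p^-1.

Definition Amean n (a q : R) (A B : 'M[R]_n) : 'M[R]_n :=
  mpow ((1 - a) *: mpow A q + a *: mpow B q) q^-1.

Definition chao_le n (X Y : 'M[R]_n) : Prop := loewner_le (mlog X) (mlog Y).

Definition near_le n (X Y : 'M[R]_n) : Prop :=
  loewner_le (gmean (2^-1) X (invmx Y)) 1%:M.

End Defs.

(* Main.v *)
Require Import Defs.
From HB Require Import structures.
From mathcomp Require Import all_boot all_order all_algebra.
From mathcomp Require Import ring lra.
From mathcomp Require Import boolp classical_sets functions reals exp.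
From mathcomp Require Import topology normedtype derive realfun.
Import Order.TTheory GRing.Theory Num.Theory.
Import numFieldNormedType.Exports.
Local Open Scope classical_set_scope.
Local Open Scope ring_scope.

(** For a <> 1/2, take A^p = diag(s^2, 1) and perturb it by a small off-diagonal
    term t to get B^p. Both means are then diag(z, 1) up to o(t) on the diagonal,
    but their off-diagonal entries differ at first order in t: they are a
    common factor times f(s) for SGtilde and times a for Amean, where f is a
    function of s that is not constantly a. Hence
    I - X # Y^-1 and log Y - log X have zero diagonal derivative and nonzero
    off-diagonal derivative, so their determinant is negative for small t.

    For a = 1/2 the first-order terms agree. Every pair of positive definite C, E
    gives SGtilde = (E C E)^(1/p) for A^p = C, B^p = E^2 C E^2. Choose E close to
    rank one with E C E diagonal, first entry at least 1, and B^p below the least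
    eigenvalue of C. Then B^q <= A^q, so Amean <= A in the chaotic order, whatever
    q is, while the first entry of log C is negative. *)

(** * Functional calculus of symmetric matrices *)

Lemma spec_decompV {R : realType} {n} {A U : 'M[R]_n} {d} :
  spec_decomp A U d -> U^T *m U = 1%:M.
Proof. by move=> [UU _]; exact: mulmx1C. Qed.

Lemma spec_decomp_sym {R : realType} {n} {A U : 'M[R]_n} {d} :
  spec_decomp A U d -> A^T = A.
Proof.
by move=> [_ ->]; rewrite !trmx_mul trmxK tr_diag_mx mulmxA.
Qed.

(** Entrywise, [d i * W i j = W i j * e j], so [d i = e j] wherever [W i j] is nonzero, and there
    [f] takes the same value. *)
Lemma diag_mx_intertwine {R : realType} {m n} (f : R -> R)
    (W : 'M[R]_(m, n)) (d : 'rV_m) (e : 'rV_n) :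
  diag_mx d *m W = W *m diag_mx e ->
  diag_mx (map_mx f d) *m W = W *m diag_mx (map_mx f e).
Proof.
move=> /matrixP dW; apply/matrixP => i j; move: (dW i j).
rewrite !mul_diag_mx !mul_mx_diag !mxE.
have [->|w0] := eqVneq (W i j) 0; first by rewrite !(mulr0, mul0r).
by rewrite [W i j * _]mulrC => /(mulIf w0) ->; rewrite mulrC.
Qed.

(** The decomposition chosen inside [mfun] need not be the given one, but the change of basis
    [U^T *m V] intertwines the two diagonals, hence also their images under [f]. *)
Lemma mfunE {R : realType} {n} (f : R -> R) {A U : 'M[R]_n} {d} :
  spec_decomp A U d -> mfun f A = U *m diag_mx (map_mx f d) *m U^T.
Proof.
move=> AUd; rewrite /mfun; case: pselect => [ex|]; last by case; exists (U, d).
case: cid => -[V e] /= AVe.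
have [UU UdA] := AUd; have [VV VeA] := AVe.
have dW : diag_mx d *m (U^T *m V) = (U^T *m V) *m diag_mx e.
  have : U^T *m (U *m diag_mx d *m U^T) *m V = U^T *m (V *m diag_mx e *m V^T) *m V.
    by rewrite -UdA -VeA.
  rewrite !mulmxA (spec_decompV AUd) mul1mx -!mulmxA (spec_decompV AVe) mulmx1.
  by [].
have := diag_mx_intertwine f _ _ _ dW.
move=> /(congr1 (fun M => U *m M *m V^T)); rewrite !mulmxA UU mul1mx => <-.
by rewrite -(mulmxA _ V) VV mulmx1.
Qed.

Lemma spec_decomp_mfun {R : realType} {n} (f : R -> R) {A U : 'M[R]_n} {d} :
  spec_decomp A U d -> spec_decomp (mfun f A) U (map_mx f d).
Proof. by move=> AUd; split; [case: AUd | exact: mfunE]. Qed.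

Lemma spec_quad {R : realType} {n} {A U : 'M[R]_n} {d} (v : 'rV[R]_n) :
  spec_decomp A U d ->
  (v *m A *m v^T) 0 0 = \sum_i d 0 i * (v *m U) 0 i ^+ 2.
Proof.
move=> [_ ->].
have -> : v *m (U *m diag_mx d *m U^T) *m v^T = v *m U *m diag_mx d *m (v *m U)^T.
  by rewrite trmx_mul !mulmxA.
rewrite mxE; apply: eq_bigr => i _.
by rewrite mul_mx_diag !mxE expr2; ring.
Qed.

Lemma quad_delta {R : realType} {n} {A U : 'M[R]_n} {d} (i : 'I_n) :
  spec_decomp A U d ->
  let v : 'rV_n := delta_mx 0 i *m U^T in (v *m A *m v^T) 0 0 = d 0 i.
Proof.
move=> AUd /=; rewrite (spec_quad _ AUd) (bigD1 i) //= big1 ?addr0.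
  by rewrite -mulmxA (spec_decompV AUd) mulmx1 mxE !eqxx expr1n mulr1.
move=> j ji; rewrite -mulmxA (spec_decompV AUd) mulmx1 mxE (negPf ji) andbF.
by rewrite expr0n mulr0.
Qed.

Lemma eigen_neq0 {R : realType} {n} {A U : 'M[R]_n} {d} (i : 'I_n) :
  spec_decomp A U d -> delta_mx 0 i *m U^T != 0 :> 'rV_n.
Proof.
move=> AUd; apply/eqP => /(congr1 (mulmx^~ U)).
rewrite -mulmxA (spec_decompV AUd) mulmx1 mul0mx => /matrixP/(_ 0 i).
by rewrite !mxE !eqxx => /eqP; rewrite oner_eq0.
Qed.

Lemma posdef_specP {R : realType} {n} {A U : 'M[R]_n} {d} :
  spec_decomp A U d -> posdef A <-> forall i, 0 < d 0 i.
Proof.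
move=> AUd; split=> [[_ A0] i|d0].
  by rewrite -(quad_delta i AUd); apply: A0; exact: eigen_neq0 AUd.
split=> [|v v0]; first exact: spec_decomp_sym AUd.
rewrite (spec_quad _ AUd).
have [i vi] : exists i, (v *m U) 0 i != 0.
  apply/existsP; apply: contraT; rewrite negb_exists => /forallP vU.
  case/negP: v0; rewrite -(mulmx1 v); case: (AUd) => <- _.
  rewrite mulmxA (_ : v *m U = 0) ?mul0mx //.
  by apply/rowP => j; rewrite [RHS]mxE; apply/eqP; rewrite -[_ == _]negbK vU.
rewrite (bigD1 i) //= ltr_pwDl ?sumr_ge0 // => [|j _].
  by rewrite mulr_gt0 // exprn_even_gt0.
by rewrite mulr_ge0 ?sqr_ge0 // ltW.
Qed.

Lemma psd_specP {R : realType} {n} {A U : 'M[R]_n} {d} :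
  spec_decomp A U d -> psd A <-> forall i, 0 <= d 0 i.
Proof.
move=> AUd; split=> [[_ A0] i|d0]; first by rewrite -(quad_delta i AUd).
split=> [|v]; first exact: spec_decomp_sym AUd.
by rewrite (spec_quad _ AUd) sumr_ge0 // => j _; rewrite mulr_ge0 ?sqr_ge0.
Qed.

Lemma spec_decomp_affine {R : realType} {n} {A U : 'M[R]_n} {d} (k l : R) :
  spec_decomp A U d ->
  spec_decomp (k *: A + l%:M) U (map_mx (fun x => k * x + l) d).
Proof.
move=> [UU AE]; split=> //.
have -> : diag_mx (map_mx (fun x => k * x + l) d) = k *: diag_mx d + l%:M.
  by apply/matrixP => i j; rewrite !mxE; case: (i == j);
    rewrite ?mulr1n // !mulr0n mulr0 addr0.
rewrite mulmxDr mulmxDl -scalemxAr -scalemxAl -AE; congr (_ + _).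
by rewrite mul_mx_scalar -scalemxAl UU scalemx1.
Qed.

Lemma mfun_comp {R : realType} {n} (f g : R -> R) {A U : 'M[R]_n} {d} :
  spec_decomp A U d -> mfun g (mfun f A) = mfun (g \o f) A.
Proof.
move=> AUd; rewrite (mfunE _ (spec_decomp_mfun f AUd)) (mfunE _ AUd).
by rewrite -map_mx_comp.
Qed.

Lemma eq_mfun {R : realType} {n} (f g : R -> R) {A U : 'M[R]_n} {d} :
  spec_decomp A U d -> (forall i, f (d 0 i) = g (d 0 i)) -> mfun f A = mfun g A.
Proof.
move=> AUd fg; rewrite !(mfunE _ AUd); congr (_ *m diag_mx _ *m _).
by apply/rowP => i; rewrite !mxE.
Qed.

Lemma mfun_affine {R : realType} {n} (f : R -> R) (k l : R) {A U : 'M[R]_n} {d} :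
  spec_decomp A U d -> mfun (fun x => k * f x + l) A = k *: mfun f A + l%:M.
Proof.
move=> AUd; rewrite (mfunE _ AUd).
have [_ ->] := spec_decomp_affine k l (spec_decomp_mfun f AUd).
by congr (_ *m diag_mx _ *m _); apply/rowP => i; rewrite !mxE.
Qed.

Lemma mfun_id {R : realType} {n} {A U : 'M[R]_n} {d} :
  spec_decomp A U d -> mfun id A = A.
Proof. by move=> AUd; rewrite (mfunE _ AUd) map_mx_id; case: AUd. Qed.

Lemma mfun_mul {R : realType} {n} (f g : R -> R) {A U : 'M[R]_n} {d} :
  spec_decomp A U d -> mfun f A *m mfun g A = mfun (fun x => f x * g x) A.
Proof.
move=> AUd; rewrite !(mfunE _ AUd) !mulmxA -(mulmxA _ U^T U) (spec_decompV AUd) mulmx1.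
rewrite -(mulmxA U) mulmx_diag; congr (_ *m diag_mx _ *m _).
by apply/rowP => i; rewrite !mxE.
Qed.

Lemma mfun_le {R : realType} {n} (f g : R -> R) {A U : 'M[R]_n} {d} :
  spec_decomp A U d -> (forall i, f (d 0 i) <= g (d 0 i)) ->
  loewner_le (mfun f A) (mfun g A).
Proof.
move=> AUd fg; rewrite /loewner_le.
have -> : mfun g A - mfun f A = mfun (fun x => g x - f x) A.
  rewrite !(mfunE _ AUd) -mulmxBl -mulmxBr -raddfB; congr (_ *m diag_mx _ *m _).
  by apply/rowP => i; rewrite !mxE.
by apply/(psd_specP (spec_decomp_mfun _ AUd)) => i; rewrite mxE subr_ge0.
Qed.

(** * Two-by-two matrices: entries, spectra and positivity *)

Definition mx2 {R : realType} (a b c d : R) : 'M[R]_2 :=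
  \matrix_(i, j) if i == 0 then (if j == 0 then a else b)
                 else (if j == 0 then c else d).

Lemma sum_I2 {R : realType} (F : 'I_2 -> R) : \sum_i F i = F 0 + F 1.
Proof.
rewrite !big_ord_recl big_ord0 addr0.
by congr (F _ + F _); exact: val_inj.
Qed.

Lemma I2P (P : 'I_2 -> Prop) : P 0 -> P 1 -> forall i, P i.
Proof.
move=> P0 P1 [[|[|//]] i2].
- by rewrite (_ : Ordinal _ = 0) //; exact: val_inj.
- by rewrite (_ : Ordinal _ = 1) //; exact: val_inj.
Qed.

Lemma mx2P {R : realType} (A B : 'M[R]_2) :
  A 0 0 = B 0 0 -> A 0 1 = B 0 1 -> A 1 0 = B 1 0 -> A 1 1 = B 1 1 -> A = B.
Proof. by move=> *; apply/matrixP; apply: I2P; apply: I2P. Qed.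

Lemma mx2E {R : realType} (A : 'M[R]_2) :
  A = mx2 (A 0 0) (A 0 1) (A 1 0) (A 1 1).
Proof. by apply: mx2P; rewrite !mxE. Qed.

Lemma mul_mx2 {R : realType} (a b c d a' b' c' d' : R) :
  mx2 a b c d *m mx2 a' b' c' d' =
  mx2 (a * a' + b * c') (a * b' + b * d') (c * a' + d * c') (c * b' + d * d').
Proof. by apply: mx2P; rewrite !mxE sum_I2 !mxE. Qed.

Lemma tr_mx2 {R : realType} (a b c d : R) : (mx2 a b c d)^T = mx2 a c b d.
Proof. by apply: mx2P; rewrite !mxE. Qed.

Lemma add_mx2 {R : realType} (a b c d a' b' c' d' : R) :
  mx2 a b c d + mx2 a' b' c' d' = mx2 (a + a') (b + b') (c + c') (d + d').
Proof. by apply: mx2P; rewrite !mxE. Qed.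

Lemma opp_mx2 {R : realType} (a b c d : R) :
  - mx2 a b c d = mx2 (- a) (- b) (- c) (- d).
Proof. by apply: mx2P; rewrite !mxE. Qed.

Lemma scale_mx2 {R : realType} (k a b c d : R) :
  k *: mx2 a b c d = mx2 (k * a) (k * b) (k * c) (k * d).
Proof. by apply: mx2P; rewrite !mxE. Qed.

Lemma scalar_mx2 {R : realType} (k : R) : k%:M = mx2 k 0 0 k.
Proof. by apply: mx2P; rewrite !mxE. Qed.

Lemma diag_mx2 {R : realType} (d : 'rV[R]_2) :
  diag_mx d = mx2 (d 0 0) 0 0 (d 0 1).
Proof. by apply: mx2P; rewrite !mxE. Qed.

Definition mx2_simp {R : realType} :=
  (@mul_mx2 R, @tr_mx2 R, @add_mx2 R, @opp_mx2 R, @scale_mx2 R,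
   @scalar_mx2 R, @diag_mx2 R).

Lemma mx2_eq {R : realType} (a b c d a' b' c' d' : R) :
  a = a' -> b = b' -> c = c' -> d = d' -> mx2 a b c d = mx2 a' b' c' d'.
Proof. by move=> -> -> -> ->. Qed.

Lemma sym_mx2 {R : realType} (A : 'M[R]_2) :
  A^T = A -> A = mx2 (A 0 0) (A 0 1) (A 0 1) (A 1 1).
Proof.
move=> AT; rewrite [LHS]mx2E; apply: mx2_eq => //.
by rewrite -[in LHS]AT mxE.
Qed.

Lemma inv_mx2 {R : realType} (a b c d : R) : a * d - b * c != 0 ->
  invmx (mx2 a b c d) = (a * d - b * c)^-1 *: mx2 d (- b) (- c) a.
Proof.
move=> D0.
have E : mx2 a b c d *m ((a * d - b * c)^-1 *: mx2 d (- b) (- c) a) = 1%:M.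
  by rewrite !mx2_simp; apply: mx2_eq; field.
have [U _] := mulmx1_unit E.
by rewrite -[LHS]mulmx1 -E mulmxA mulVmx // mul1mx.
Qed.

Lemma spec_decomp2 {R : realType} (A : 'M[R]_2) :
  A^T = A -> exists U d, spec_decomp A U d.
Proof.
move/sym_mx2 ->; set a := A 0 0; set b := A 0 1; set c := A 1 1.
suff [u [v [l [uv e1 e2]]]] : exists u v l : R,
    [/\ u ^+ 2 + v ^+ 2 = 1, a * u + b * v = l * u & b * u + c * v = l * v].
  (* The second eigenvector is the first one turned by a right angle; its eigenvalue is read off the
     trace. *)
  exists (mx2 u (- v) v u), (\row_i if i == 0 then l else a + c - l).
  (* The entrywise identities are linear combinations of these multiples of [e1], [e2] and [uv]. *)
  have [h1 h2] := (congr1 (fun z => u * z) e1, congr1 (fun z => v * z) e1).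
  have [h3 h4] := (congr1 (fun z => u * z) e2, congr1 (fun z => v * z) e2).
  have h5 := congr1 (fun z => a * z) uv; have h6 := congr1 (fun z => b * z) uv.
  have h7 := congr1 (fun z => c * z) uv.
  by split; rewrite !mx2_simp ?mxE /=; apply: mx2_eq; lra.
have [b0|b0] := eqVneq b 0.
  by exists 1, 0, a; rewrite b0; split; ring.
(* [l] is the larger root of the characteristic polynomial, and [(b, l - a)], of norm [m], is an
   eigenvector, nonzero because [b] is. *)
pose r := Num.sqrt ((a - c) ^+ 2 + 4 * b ^+ 2); pose l := (a + c + r) / 2.
have rr : r ^+ 2 = (a - c) ^+ 2 + 4 * b ^+ 2.
  by rewrite sqr_sqrtr // addr_ge0 ?sqr_ge0 // mulr_ge0 ?sqr_ge0.
have ll : (l - a) * (l - c) = b ^+ 2 by rewrite /l; move: rr; lra.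
pose m := Num.sqrt (b ^+ 2 + (l - a) ^+ 2).
have mm : m ^+ 2 = b ^+ 2 + (l - a) ^+ 2 by rewrite sqr_sqrtr ?addr_ge0 ?sqr_ge0.
have m0 : m != 0.
  rewrite -sqrf_eq0 mm gt_eqF // ltr_pwDl ?sqr_ge0 //.
  by rewrite exprn_even_gt0.
exists (b / m), ((l - a) / m), l; split.
- by rewrite !expr_div_n -mulrDl -mm divff // sqrf_eq0.
- by ring.
- by rewrite !mulrA -mulrDl; congr (_ / m); move: ll; lra.
Qed.

Lemma posdef_spec {R : realType} (A : 'M[R]_2) : posdef A ->
  exists U d, spec_decomp A U d /\ forall i, 0 < d 0 i.
Proof.
move=> A0; have [U [d AUd]] := spec_decomp2 A A0.1.
by exists U, d; split=> //; apply/(posdef_specP AUd).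
Qed.

(* Lagrange interpolation of f at the two eigenvalues (tr +- r) / 2. *)
Lemma mfun_mx2 {R : realType} (f : R -> R) (a b c r : R) :
  r != 0 -> r ^+ 2 = (a - c) ^+ 2 + 4 * b ^+ 2 ->
  let x := (a + c + r) / 2 in let y := (a + c - r) / 2 in
  let k := (f x - f y) / r in let l := f y - k * y in
  mfun f (mx2 a b b c) = mx2 (k * a + l) (k * b) (k * b) (k * c + l).
Proof.
move=> r0 rr x y k l.
have [U [d AUd]] := spec_decomp2 (mx2 a b b c) (tr_mx2 _ _ _ _).
have fx : k * x + l = f x by rewrite /l /k /x /y; field.
have fy : k * y + l = f y by rewrite /l; ring.
(* By Cayley-Hamilton [(A - x)(A - y) = 0], so every eigenvalue is [x] or [y]; at both points [f]
   agrees with [k z + l]. *)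
have dxy i : (d 0 i - x) * (d 0 i - y) = 0.
  have := mfun_mul (fun z => 1 * id z + (- x)) (fun z => 1 * id z + (- y)) AUd.
  rewrite !(mfun_affine _ _ _ AUd) (mfun_id AUd) => E.
  have /= := quad_delta i (spec_decomp_mfun (fun z => (1 * z + - x) * (1 * z + - y)) AUd).
  rewrite -E (_ : (_ + _) *m (_ + _) = 0); last first.
    by rewrite !mx2_simp; apply: mx2P; rewrite !mxE /= /x /y; move: rr; lra.
  by rewrite mulmx0 mul0mx !mxE !mul1r => <-.
have fd i : f (d 0 i) = k * id (d 0 i) + l.
  have /eqP := dxy i; rewrite mulf_eq0 !subr_eq0.
  by case/orP => /eqP ->; rewrite ?fx ?fy.
rewrite (eq_mfun f (fun z => k * id z + l) AUd fd) (mfun_affine _ _ _ AUd).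
by rewrite (mfun_id AUd) !mx2_simp !addr0.
Qed.

(** Completing the square: [a] times the quadratic form is [(a x + b y)^2 + (a c - b^2) y^2]. *)
Lemma psd_mx2 {R : realType} (a b c : R) :
  0 < a -> b ^+ 2 <= a * c -> psd (mx2 a b b c).
Proof.
move=> a0 bac; split=> [|v]; first by rewrite tr_mx2.
rewrite mxE sum_I2 !mxE !sum_I2 !mxE /=.
set x := v 0 0; set y := v 0 1.
have : 0 <= (a * x + b * y) ^+ 2 + (a * c - b ^+ 2) * y ^+ 2.
  by rewrite addr_ge0 ?sqr_ge0 // mulr_ge0 ?sqr_ge0 // subr_ge0.
rewrite (_ : _ + _ = a * ((x * a + y * b) * x + (x * b + y * c) * y)); last by ring.
by rewrite pmulr_rge0.
Qed.

Lemma psd_mx2_det {R : realType} (a b c : R) :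
  psd (mx2 a b b c) -> b ^+ 2 <= a * c.
Proof.
move=> [_ P].
have Q (x y : R) : 0 <= a * x ^+ 2 + 2 * b * x * y + c * y ^+ 2.
  have := P (\row_j if j == 0 then x else y).
  by rewrite mxE sum_I2 !mxE !sum_I2 !mxE /=; lra.
have c0 : 0 <= c by have := Q 0 1; lra.
(* For [c = 0] the test vector [(b, - (a + 1) / 2)] gives [- b^2]; otherwise [(c, - b)] gives
   [c (a c - b^2)]. *)
have [c00|cn] := eqVneq c 0.
  by have := Q b (- (a + 1) / 2); rewrite c00; lra.
have := Q c (- b).
rewrite (_ : _ + _ = c * (a * c - b ^+ 2)); last by ring.
by rewrite pmulr_rge0 ?subr_ge0 // lt_def cn.
Qed.

Lemma posdef_mx2 {R : realType} (a b c : R) :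
  0 < a -> b ^+ 2 < a * c -> posdef (mx2 a b b c).
Proof.
move=> a0 bac; split=> [|v v0]; first by rewrite tr_mx2.
rewrite mxE sum_I2 !mxE !sum_I2 !mxE /=.
have {v0} : (v 0 0 != 0) || (v 0 1 != 0).
  apply: contraR v0; rewrite negb_or !negbK => /andP[/eqP v0 /eqP v1].
  by apply/eqP/matrixP => i; rewrite ord1; apply: I2P; rewrite mxE.
set x := v 0 0; set y := v 0 1 => xy.
have : 0 < (a * x + b * y) ^+ 2 + (a * c - b ^+ 2) * y ^+ 2.
  have [y0|y0] := eqVneq y 0.
    move: xy; rewrite y0 eqxx orbF => x0.
    rewrite !mulr0 expr0n mulr0 !addr0 exprn_even_gt0 //=.
    by rewrite mulf_neq0 // gt_eqF.
  rewrite ltr_wpDl ?sqr_ge0 // mulr_gt0 ?subr_gt0 //.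
  by rewrite exprn_even_gt0.
rewrite (_ : _ + _ = a * ((x * a + y * b) * x + (x * b + y * c) * y)); last by ring.
by rewrite pmulr_rgt0.
Qed.

(** * Real powers of positive definite matrices *)

Lemma posdef_mfun {R : realType} (f : R -> R) (A : 'M[R]_2) :
  posdef A -> (forall x, 0 < x -> 0 < f x) -> posdef (mfun f A).
Proof.
move=> /posdef_spec[U [d [AUd d0]]] f0.
by apply/(posdef_specP (spec_decomp_mfun f AUd)) => i; rewrite mxE f0.
Qed.

Lemma posdef_mpow {R : realType} (A : 'M[R]_2) s : posdef A -> posdef (mpow A s).
Proof. by move=> A0; apply: posdef_mfun => // x x0; exact: powR_gt0. Qed.

Lemma mpow_mpow {R : realType} (A : 'M[R]_2) s t : posdef A ->
  mpow (mpow A s) t = mpow A (s * t).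
Proof.
move=> /posdef_spec[U [d [AUd d0]]]; rewrite /mpow (mfun_comp _ _ AUd).
by apply: (eq_mfun _ _ AUd) => i /=; rewrite powRrM.
Qed.

Lemma mpow1 {R : realType} (A : 'M[R]_2) : posdef A -> mpow A 1 = A.
Proof.
move=> /posdef_spec[U [d [AUd d0]]]; rewrite -[RHS](mfun_id AUd).
by apply: (eq_mfun _ _ AUd) => i; rewrite powRr1 // ltW.
Qed.

Lemma mpowK {R : realType} (A : 'M[R]_2) s : posdef A -> s != 0 ->
  mpow (mpow A s^-1) s = A.
Proof. by move=> A0 s0; rewrite mpow_mpow // mulVf // mpow1. Qed.

Lemma mpowD {R : realType} (A : 'M[R]_2) s t : posdef A ->
  mpow A s *m mpow A t = mpow A (s + t).
Proof.
move=> /posdef_spec[U [d [AUd d0]]]; rewrite (mfun_mul _ _ AUd).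
by apply: (eq_mfun _ _ AUd) => i; rewrite powRD // (gt_eqF (d0 i)) implybT.
Qed.

Lemma mpow0 {R : realType} (A : 'M[R]_2) : posdef A -> mpow A 0 = 1%:M.
Proof.
move=> /posdef_spec[U [d [AUd d0]]].
rewrite /mpow (eq_mfun (fun x => x `^ 0) (fun x => 0 * id x + 1) AUd).
  by rewrite (mfun_affine _ _ _ AUd) scale0r add0r.
by move=> i; rewrite powRr0 mul0r add0r.
Qed.

Lemma invmx_mpow {R : realType} (A : 'M[R]_2) s : posdef A ->
  mpow (invmx A) s = mpow A (- s).
Proof.
move=> A0.
suff -> : invmx A = mpow A (- 1) by rewrite mpow_mpow // mulN1r.
have E : A *m mpow A (- 1) = 1%:M.
  by rewrite -[A in A *m _]mpow1 // mpowD // subrr mpow0.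
have [U _] := mulmx1_unit E.
by rewrite -[LHS]mulmx1 -E mulmxA mulVmx // mul1mx.
Qed.

Lemma mpow_sqr {R : realType} (A : 'M[R]_2) : posdef A ->
  mpow (A *m A) 2^-1 = A.
Proof.
move=> A0; rewrite -{1 2}[A]mpow1 // mpowD // mpow_mpow //.
by rewrite (_ : (1 + 1) / 2 = 1 :> R) ?mpow1 //; lra.
Qed.

(** * First-order perturbation of diagonal matrices *)

(* f(0) = x and f'(0) = f1 *)
Definition jet {R : realType} (f : R -> R) (x f1 : R) : Prop :=
  f 0 = x /\ is_derive (0 : R) (1 : R) f f1.

Lemma jet_eq {R : realType} {f : R -> R} {x f1 y g1 : R} :
  jet f x f1 -> x = y -> f1 = g1 -> jet f y g1.
Proof. by move=> ? <- <-. Qed.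

Lemma jet_cst {R : realType} (k : R) : jet (fun=> k) k 0.
Proof. by split=> //; exact: is_derive_cst. Qed.

Lemma jet_id {R : realType} : jet (@id R) 0 1.
Proof. by split=> //; exact: is_derive_id. Qed.

Lemma jetD {R : realType} {f g : R -> R} {x f1 y g1 : R} :
  jet f x f1 -> jet g y g1 -> jet (fun t => f t + g t) (x + y) (f1 + g1).
Proof. by move=> [<- df] [<- dg]; split=> //; exact: is_deriveD. Qed.

Lemma jetN {R : realType} {f : R -> R} {x f1 : R} :
  jet f x f1 -> jet (fun t => - f t) (- x) (- f1).
Proof. by move=> [<- df]; split=> //; exact: is_deriveN. Qed.

Lemma jetM {R : realType} {f g : R -> R} {x f1 y g1 : R} :
  jet f x f1 -> jet g y g1 -> jet (fun t => f t * g t) (x * y) (x * g1 + y * f1).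
Proof. by move=> [<- df] [<- dg]; split=> //; exact: is_deriveM. Qed.

Lemma jetV {R : realType} {f : R -> R} {x f1 : R} : x != 0 ->
  jet f x f1 -> jet (fun t => (f t)^-1) x^-1 (- x ^- 2 * f1).
Proof. by move=> + [xE df]; rewrite -xE => x0; split=> //; exact: is_deriveV. Qed.

Lemma jet_comp {R : realType} {h f : R -> R} {x f1 h1 : R} :
  is_derive x 1 h h1 -> jet f x f1 -> jet (fun t => h (f t)) (h x) (h1 * f1).
Proof. by move=> + [xE df]; rewrite -xE => dh; split=> //; exact: is_derive1_comp. Qed.

Lemma jet_cvg {R : realType} {f : R -> R} {x f1 : R} :
  jet f x f1 -> f t @[t --> (0 : R)] --> x.
Proof.
move=> [<- [df _]].
by apply: differentiable_continuous; apply/derivable1_diffP.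
Qed.

Lemma jet_gt {R : realType} {f : R -> R} {x f1 z : R} :
  jet f x f1 -> z < x -> \forall t \near (0 : R), z < f t.
Proof. by move=> /jet_cvg fx zx; apply: (@cvgr_gt _ _ (nbhs (0 : R)) _ f x fx). Qed.

Lemma jet_neq {R : realType} {f : R -> R} {x f1 z : R} :
  jet f x f1 -> x != z -> \forall t \near (0 : R), f t != z.
Proof.
move=> fx; case: ltgtP => // xz _.
  have : - z < - x by rewrite ltrN2.
  by move=> /(jet_gt (jetN fx)); apply: filterS => t; rewrite ltrN2 => /lt_eqF ->.
by have := jet_gt fx xz; apply: filterS => t /gt_eqF ->.
Qed.

(* M t = diag(x, y) + t m J + o(t), J being the off-diagonal symmetric unit: the
   diagonal has zero derivative at 0, which functional calculus preserves. *)
Definition diag_tangent {R : realType} (M : R -> 'M[R]_2) (x m y : R) : Prop :=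
  exists a b c : R -> R,
    [/\ \forall t \near (0 : R), M t = mx2 (a t) (b t) (b t) (c t),
        jet a x 0, jet b 0 m & jet c y 0].

Lemma diag_tangent_eq {R : realType} {M : R -> 'M[R]_2} {x m y x' m' y' : R} :
  diag_tangent M x m y -> x = x' -> m = m' -> y = y' -> diag_tangent M x' m' y'.
Proof. by move=> ? <- <- <-. Qed.

Lemma diag_tangent_near {R : realType} {M N : R -> 'M[R]_2} {x m y : R} :
  (\forall t \near (0 : R), M t = N t) -> diag_tangent M x m y -> diag_tangent N x m y.
Proof.
move=> MN [a [b [c [Me ja jb jc]]]]; exists a, b, c; split=> //.
by move: MN Me; apply: filterS2 => t ->.
Qed.

Lemma diag_tangent_affine {R : realType} (x m y : R) :
  diag_tangent (fun t => mx2 x (m * t) (m * t) y) x m y.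
Proof.
exists (fun=> x), (fun t => m * t), (fun=> y); split; try exact: jet_cst.
  by near=> t.
by apply: jet_eq (jetM (jet_cst m) jet_id) _ _; rewrite ?mulr0 ?mulr1 ?mul0r ?addr0.
Unshelve. all: by end_near. Qed.

Lemma diag_tangent_cst {R : realType} (x y : R) :
  diag_tangent (fun=> mx2 x 0 0 y) x 0 y.
Proof.
by exists (fun=> x), (fun=> 0), (fun=> y); split; try exact: jet_cst; near=> t.
Unshelve. all: by end_near. Qed.

Lemma diag_tangentD {R : realType} {M N : R -> 'M[R]_2} {x m y x' m' y' : R} :
  diag_tangent M x m y -> diag_tangent N x' m' y' ->
  diag_tangent (fun t => M t + N t) (x + x') (m + m') (y + y').
Proof.
move=> [a [b [c [Me ja jb jc]]]] [a' [b' [c' [Ne ja' jb' jc']]]].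
exists (fun t => a t + a' t), (fun t => b t + b' t), (fun t => c t + c' t).
split.
- by move: Me Ne; apply: filterS2 => t -> ->; rewrite add_mx2.
- by apply: jet_eq (jetD ja ja') _ _; rewrite ?addr0.
- by apply: jet_eq (jetD jb jb') _ _; rewrite ?addr0.
- by apply: jet_eq (jetD jc jc') _ _; rewrite ?addr0.
Qed.

Lemma diag_tangentZ {R : realType} (k : R) {M : R -> 'M[R]_2} {x m y : R} :
  diag_tangent M x m y -> diag_tangent (fun t => k *: M t) (k * x) (k * m) (k * y).
Proof.
move=> [a [b [c [Me ja jb jc]]]].
exists (fun t => k * a t), (fun t => k * b t), (fun t => k * c t).
split.
- by move: Me; apply: filterS => t ->; rewrite scale_mx2.
- by apply: jet_eq (jetM (jet_cst k) ja) _ _; ring.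
- by apply: jet_eq (jetM (jet_cst k) jb) _ _; ring.
- by apply: jet_eq (jetM (jet_cst k) jc) _ _; ring.
Qed.

Lemma diag_tangentB {R : realType} {M N : R -> 'M[R]_2} {x m y x' m' y' : R} :
  diag_tangent M x m y -> diag_tangent N x' m' y' ->
  diag_tangent (fun t => M t - N t) (x - x') (m - m') (y - y').
Proof.
move=> Mt /(diag_tangentZ (-1)) Nt.
apply: (@diag_tangent_near _ (fun t => M t + -1 *: N t)).
  by near=> t; rewrite scaleN1r.
by apply: diag_tangent_eq (diag_tangentD Mt Nt) _ _ _; rewrite mulN1r.
Unshelve. all: by end_near. Qed.

(** A plain product need not be symmetric; this sandwich is, and all products in [gmean] and
    [Ftilde] have this form. *)
Lemma diag_tangent_conj {R : realType} {M N : R -> 'M[R]_2} {x m y x' m' y' : R} :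
  diag_tangent M x m y -> diag_tangent N x' m' y' ->
  diag_tangent (fun t => M t *m N t *m M t)
    (x * x' * x) (x * m' * y + x * x' * m + m * y' * y) (y * y' * y).
Proof.
move=> [a [b [c [Me ja jb jc]]]] [a' [b' [c' [Ne ja' jb' jc']]]].
exists (fun t => (a t * a' t + b t * b' t) * a t + (a t * b' t + b t * c' t) * b t),
  (fun t => (a t * a' t + b t * b' t) * b t + (a t * b' t + b t * c' t) * c t),
  (fun t => (b t * a' t + c t * b' t) * b t + (b t * b' t + c t * c' t) * c t).
split.
- by move: Me Ne; apply: filterS2 => t -> ->; rewrite !mul_mx2; apply: mx2_eq => //; ring.
- by apply: jet_eq
    (jetD (jetM (jetD (jetM ja ja') (jetM jb jb')) ja)
          (jetM (jetD (jetM ja jb') (jetM jb jc')) jb)) _ _; ring.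
- by apply: jet_eq
    (jetD (jetM (jetD (jetM ja ja') (jetM jb jb')) jb)
          (jetM (jetD (jetM ja jb') (jetM jb jc')) jc)) _ _; ring.
- by apply: jet_eq
    (jetD (jetM (jetD (jetM jb ja') (jetM jc jb')) jb)
          (jetM (jetD (jetM jb jb') (jetM jc jc')) jc)) _ _; ring.
Qed.

Lemma diag_tangentV {R : realType} {M : R -> 'M[R]_2} {x m y : R} :
  x != 0 -> y != 0 -> diag_tangent M x m y ->
  diag_tangent (fun t => invmx (M t)) x^-1 (- m / (x * y)) y^-1.
Proof.
move=> x0 y0 [a [b [c [Me ja jb jc]]]].
have jD := jetD (jetM ja jc) (jetN (jetM jb jb)).
have D0 : x * y - 0 * 0 != 0 by rewrite mulr0 subr0 mulf_neq0.
have jDV := jetV D0 jD.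
exists (fun t => (a t * c t - b t * b t)^-1 * c t),
  (fun t => (a t * c t - b t * b t)^-1 * (- b t)),
  (fun t => (a t * c t - b t * b t)^-1 * a t).
split.
- by move: Me (jet_neq jD D0); apply: filterS2 => t -> Dt; rewrite inv_mx2 ?scale_mx2.
- by apply: jet_eq (jetM jDV jc) _ _; rewrite ?mulr0 ?subr0; field; rewrite x0 y0.
- by apply: jet_eq (jetM jDV (jetN jb)) _ _; rewrite ?mulr0 ?subr0; field; rewrite x0 y0.
- by apply: jet_eq (jetM jDV ja) _ _; rewrite ?mulr0 ?subr0; field; rewrite x0 y0.
Qed.

(* The square root of the discriminant is taken with the sign of x - y, so that
   the two eigenvalues are differentiable branches through x and y. *)
Lemma diag_tangent_mfun {R : realType} (f : R -> R) {M : R -> 'M[R]_2}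
    {x m y f1 f2 : R} : x != y ->
  is_derive x 1 f f1 -> is_derive y 1 f f2 -> diag_tangent M x m y ->
  diag_tangent (fun t => mfun f (M t)) (f x) ((f x - f y) / (x - y) * m) (f y).
Proof.
move=> xy df1 df2 [a [b [c [Me ja jb jc]]]].
have d0 : x - y != 0 by rewrite subr_eq0.
(* The discriminant is scaled so that [q 0 = 1], where the square root is differentiable. *)
pose q t := ((a t - c t) * (a t - c t) + 4 * (b t * b t)) * (x - y) ^- 2.
have jac := jetD ja (jetN jc).
have jq : jet q 1 0.
  apply: jet_eq (jetM (jetD (jetM jac jac)
    (jetM (jet_cst 4) (jetM jb jb))) (jet_cst ((x - y) ^- 2))) _ _; by field.
pose r t := (x - y) * Num.sqrt (q t).
have jr : jet r (x - y) 0.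
  have js := jet_comp (is_derive1_sqrt (ltr01 : 0 < 1 :> R)) jq.
  by apply: jet_eq (jetM (jet_cst (x - y)) js) _ _; rewrite ?sqrtr1; ring.
have rr t : r t ^+ 2 = (a t - c t) ^+ 2 + 4 * b t ^+ 2.
  rewrite /r exprMn sqr_sqrtr; first by rewrite /q; field.
  rewrite /q mulr_ge0 ?invr_ge0 ?sqr_ge0 // addr_ge0 //.
    by rewrite -expr2 sqr_ge0.
  by rewrite mulr_ge0 // -expr2 sqr_ge0.
have jx : jet (fun t => (a t + c t + r t) / 2) x 0.
  by apply: jet_eq (jetM (jetD (jetD ja jc) jr) (jet_cst 2^-1)) _ _; field.
have jy : jet (fun t => (a t + c t - r t) / 2) y 0.
  by apply: jet_eq (jetM (jetD (jetD ja jc) (jetN jr)) (jet_cst 2^-1)) _ _; field.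
have jfx := jet_comp df1 jx; have jfy := jet_comp df2 jy.
(* This is the divided difference of [f] at the two eigenvalues. Both eigenvalues have zero
   derivative, hence so has the quotient, and the off-diagonal slope is its value at 0 times [m]. *)
have jk := jetM (jetD jfx (jetN jfy)) (jetV d0 jr).
have jl := jetD jfy (jetN (jetM jk jy)).
eexists _, _, _; split.
- by move: Me (jet_neq jr d0); apply: filterS2 => t -> rt;
    rewrite (mfun_mx2 f _ _ _ _ rt (rr t)).
- by apply: jet_eq (jetD (jetM jk ja) jl) _ _; field.
- by apply: jet_eq (jetM jk jb) _ _; field.
- by apply: jet_eq (jetD (jetM jk jc) jl) _ _; field.
Qed.

Lemma diag_tangent_mpow {R : realType} (s : R) {M : R -> 'M[R]_2} {x m y : R} :
  x != y -> 0 < x -> 0 < y -> diag_tangent M x m y ->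
  diag_tangent (fun t => mpow (M t) s)
    (x `^ s) ((x `^ s - y `^ s) / (x - y) * m) (y `^ s).
Proof.
by move=> xy x0 y0; apply: diag_tangent_mfun => //; exact: is_derive1_powR.
Qed.

Lemma diag_tangent_mlog {R : realType} {M : R -> 'M[R]_2} {x m y : R} :
  x != y -> 0 < x -> 0 < y -> diag_tangent M x m y ->
  diag_tangent (fun t => mlog (M t)) (ln x) ((ln x - ln y) / (x - y) * m) (ln y).
Proof.
by move=> xy x0 y0; apply: diag_tangent_mfun => //; exact: is_derive1_ln.
Qed.

Lemma diag_tangent_posdef {R : realType} {M : R -> 'M[R]_2} {x m y : R} :
  0 < x -> 0 < y -> diag_tangent M x m y -> \forall t \near (0 : R), posdef (M t).
Proof.
move=> x0 y0 [a [b [c [Me ja jb jc]]]].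
have jD := jetD (jetM ja jc) (jetN (jetM jb jb)).
have D0 : 0 < x * y - 0 * 0 by rewrite mulr0 subr0 mulr_gt0.
move: Me (jet_gt ja x0) (jet_gt jD D0); apply: filterS3 => t -> a0 Dt.
by apply: posdef_mx2; rewrite // expr2 -subr_gt0.
Qed.

(** The determinant divided by [t^2] tends to [- m^2 < 0], whereas a positive semidefinite matrix
    has nonnegative determinant. *)
Lemma diag_tangent_not_psd {R : realType} {M : R -> 'M[R]_2} {m : R} :
  m != 0 -> diag_tangent M 0 m 0 -> \forall t \near (0 : R)^', ~ psd (M t).
Proof.
move=> m0 [a [b [c [Me ja jb jc]]]].
have quot (f : R -> R) (f1 : R) : jet f 0 f1 -> t^-1 * f t @[t --> (0 : R)^'] --> f1.
  move=> [f0 [df <-]]; rewrite /derive.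
  have -> : (fun t => t^-1 * f t) =
      (fun h => h^-1 *: ((f \o shift 0) (h *: (1 : R)) - f 0)).
    by apply/funext => h /=; rewrite f0 subr0 addr0 [_%:A]mulr1.
  exact: df.
pose g t := t^-1 * a t * (t^-1 * c t) - t^-1 * b t * (t^-1 * b t).
have cv : g t @[t --> (0 : R)^'] --> 0 * 0 - m * m.
  by apply: cvgB; apply: cvgM; exact: quot.
have lim_lt0 : 0 * 0 - m * m < 0.
  by rewrite mulr0 sub0r oppr_lt0 -expr2 exprn_even_gt0.
have neg : \forall t \near (0 : R)^', g t < 0.
  by apply: (@cvgr_lt _ _ (0 : R)^' _ g _ cv).
have Md : \forall t \near (0 : R)^', M t = mx2 (a t) (b t) (b t) (c t).
  exact: nbhs_dnbhs Me.
near=> t => Mp.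
have t0 : t != 0 by near: t; exact: nbhs_dnbhs_neq.
have Mt : M t = mx2 (a t) (b t) (b t) (c t) by near: t.
have : g t < 0 by near: t.
rewrite (_ : g t = t ^- 2 * (a t * c t - b t ^+ 2)); last by rewrite /g; field.
rewrite pmulr_rlt0 ?invr_gt0 ?exprn_even_gt0 // subr_lt0 ltNge => /negP; apply.
by apply: psd_mx2_det; rewrite -Mt.
Unshelve. all: by end_near. Qed.

(** * First-order expansions of the geometric mean and of [Ftilde] *)

Lemma powR_half_sqr {R : realType} (s : R) : 0 < s -> (s ^+ 2) `^ 2^-1 = s.
Proof. by move=> s0; rewrite powR12_sqrt ?sqr_ge0 // sqrtr_sqr gtr0_norm. Qed.

Lemma powR_Nhalf_sqr {R : realType} (s : R) : 0 < s ->
  (s ^+ 2) `^ (- 2^-1) = s^-1.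
Proof. by move=> s0; rewrite powRN powR_half_sqr. Qed.

(** The first-order rules are chained through the definition of [gmean]. Writing the upper entry of
    [M] as [s^2] makes its half powers [s] and [1/s], so the slope is rational in [s], [z] and [v].
    The condition [z != s ^+ 2] keeps the eigenvalues of the inner matrix distinct at 0. *)
Lemma diag_tangent_gmean {R : realType} (a : R) {M N : R -> 'M[R]_2}
    {s m z n : R} (v := (z / s ^+ 2) `^ a) :
  0 < s -> s != 1 -> 0 < z -> z != s ^+ 2 ->
  diag_tangent M (s ^+ 2) m 1 -> diag_tangent N z n 1 ->
  diag_tangent (fun t => gmean a (M t) (N t)) (s ^+ 2 * v)
    (s * ((v - 1) / (z / s ^+ 2 - 1) * (n / s - (z / s + 1) * m / (s * (s + 1))))
       + (s * v + 1) * m / (s + 1)) 1.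
Proof.
move=> s0 s1 z0 zs Mt Nt.
have s_neq0 : s != 0 by rewrite gt_eqF.
have s21 : s ^+ 2 != 1.
  by rewrite sqrf_eq1 negb_or s1 /= gt_eqF // (lt_trans _ s0) // oppr_lt0.
have sD : s + 1 != 0 by rewrite gt_eqF // addr_gt0.
have sB : s - 1 != 0 by rewrite subr_eq0.
have s2B : s ^+ 2 - 1 != 0 by rewrite subr_eq0.
have s20 : 0 < s ^+ 2 by rewrite exprn_gt0.
have M1 := diag_tangent_mpow 2^-1 s21 s20 ltr01 Mt.
have M2 := diag_tangent_mpow (- 2^-1) s21 s20 ltr01 Mt.
rewrite !powR1 powR_half_sqr // in M1; rewrite !powR1 powR_Nhalf_sqr // in M2.
have inner := diag_tangent_conj M2 Nt; rewrite !mulr1 in inner.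
have zsE : s^-1 * z * s^-1 = z / s ^+ 2 by field.
have zs1 : s^-1 * z * s^-1 != 1.
  by rewrite zsE; apply: contra zs => /eqP h; rewrite -[z](divfK (lt0r_neq0 s20)) h mul1r.
have zs0 : 0 < s^-1 * z * s^-1 by rewrite zsE divr_gt0.
have outer := diag_tangent_conj M1 (diag_tangent_mpow a zs1 zs0 ltr01 inner).
apply: diag_tangent_eq outer _ _ _; rewrite ?powR1 ?zsE -/v.
- by ring.
- set k := (v - 1) / (_ - 1).
  by field; rewrite s_neq0 sD s2B.
- by ring.
Qed.

Lemma powR_gt1 {R : realType} (x e : R) : 1 < x -> 0 < e -> 1 < x `^ e.
Proof.
move=> x1 e0; rewrite -[ltLHS](congr1 (fun f => f e) (@powR1 R)).
by rewrite gt0_ltr_powR // ?nnegrE // ltW // (lt_trans ltr01).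
Qed.

(* With w = s^(2a), the quotient of the two sides without the factor a is the
   off-diagonal slope f(s) of diag_tangent_Ftilde; as s tends to infinity it
   tends to 1 if a > 1/2 and to 0 if a < 1/2. *)
Lemma ratio_neq {R : realType} {a : R} : 0 < a -> a < 1 -> a != 2^-1 ->
  exists2 s : R, 1 < s & let w := s `^ (2 * a) in
    (w ^+ 2 - 1) * (s ^+ 3 + w) * s != a * w * (s ^+ 4 - 1) * (w + s).
Proof.
move=> a0 a1 ah.
have big (c e : R) : 1 < c -> 0 < e ->
    exists2 s : R, 1 < s & s `^ e = c.
  move=> c1 e0; have c0 : 0 < c by apply: lt_trans c1.
  exists (c `^ e^-1); last by rewrite -powRrM mulVf ?gt_eqF // powRr1 // ltW.
  by rewrite powR_gt1 ?invr_gt0.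
case: (ltgtP a 2^-1) => [ah'|ah'|E]; last by rewrite E eqxx in ah.
(* This [s] satisfies [a s = 4 w]. The right side then contains [a w s^5 = 4 w^2 s^4], which
   outweighs the terms [w^2 s^4 + w^3 s] of the left side. *)
- have [||s s1 sE] := big (4 / a) (1 - 2 * a).
  + by rewrite ltr_pdivlMr //; lra.
  + lra.
  exists s => //=; set w := s `^ (2 * a).
  have s0 : 0 < s by apply: lt_trans s1.
  have w1 : 1 <= w by rewrite -(powRr0 s) ler_powR ?ltW //; lra.
  have wE : a * s = 4 * w.
    have : s = w * (4 / a).
      rewrite -sE /w -powRD ?(gt_eqF s0) ?implybT //.
      by rewrite (_ : 2 * a + (1 - 2 * a) = 1) ?powRr1 ?ltW //; ring.
    by move=> ->; field; rewrite gt_eqF.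
  have ws : w <= s by rewrite -[leRHS](powRr1 (ltW s0)) ler_powR ?ltW //; lra.
  have w0 : 0 < w by lra.
  rewrite lt_eqF //.
  have s1' := ltW s1; have s3 : w <= s ^+ 3 by apply: le_trans ws _; rewrite ler_eXnr.
  have h1 : w ^+ 2 * s * w <= w ^+ 2 * s * s ^+ 3.
    by rewrite ler_wpM2l // mulr_ge0 ?exprn_ge0 // ltW.
  have h2 : w ^+ 2 <= w ^+ 2 * s ^+ 4 by rewrite ler_peMr ?exprn_ge0 ?exprn_ege1 // ltW.
  have h3 : 0 < w ^+ 2 * s ^+ 4 by rewrite mulr_gt0 ?exprn_gt0.
  have h4 : a * w ^+ 2 <= a * (w ^+ 2 * s ^+ 4) by rewrite ler_wpM2l // ltW.
  have h5 : 0 <= (1 - a) * (w * s) by rewrite !mulr_ge0 ?subr_ge0 // ltW.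
  have h6 : 0 < s ^+ 4 by rewrite exprn_gt0.
  have h7 : a * s * (w * s ^+ 4) = 4 * w * (w * s ^+ 4) by rewrite wE.
  lra.
(* This [s] satisfies [(1 - a) w = 4 s]. The difference of the sides then contains
   [(1 - a) w^2 s^4 = 4 w s^5], which outweighs [a w s^5] and the lower terms. *)
- have [||s s1 sE] := big (4 / (1 - a)) (2 * a - 1).
  + by rewrite ltr_pdivlMr ?subr_gt0 //; lra.
  + lra.
  exists s => //=; set w := s `^ (2 * a).
  have s0 : 0 < s by apply: lt_trans s1.
  have w1 : 1 <= w by rewrite -(powRr0 s) ler_powR ?ltW //; lra.
  have wE : (1 - a) * w = 4 * s.
    have -> : w = s * (4 / (1 - a)).
      rewrite -sE -[X in X * _](powRr1 (ltW s0)) -powRD ?(gt_eqF s0) ?implybT //.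
      by rewrite addrC subrK.
    by field; rewrite gt_eqF // subr_gt0.
  rewrite gt_eqF //.
  have w0 : 0 < w by lra.
  have s41 : 1 <= s ^+ 4 by rewrite exprn_ege1 // ltW.
  have ws1 : s ^+ 4 <= s ^+ 4 * (w * s).
    by rewrite ler_peMr ?mulr_ege1 ?exprn_ge0 // ltW.
  have ws2 : w * s <= w * s * s ^+ 4 by rewrite ler_peMr // mulr_ge0 // ltW.
  have h1 : (1 - a) * w * (w * s ^+ 4) = 4 * s * (w * s ^+ 4) by rewrite wE.
  have h2 : 0 < w * s ^+ 5 by rewrite mulr_gt0 // exprn_gt0.
  have h3 : a * (w * s ^+ 5) <= 1 * (w * s ^+ 5) by rewrite ler_wpM2r // ltW.
  have h4 : (1 - a) * (w * s) <= 1 * (w * s) by rewrite ler_wpM2r ?mulr_ge0 ?ltW //; lra.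
  have h5 : 0 <= a * w ^+ 2 by rewrite mulr_ge0 ?exprn_ge0 // ltW.
  have h6 : 0 < w ^+ 3 * s by rewrite mulr_gt0 ?exprn_gt0.
  lra.
Qed.

(** Here [w^2 = (s^4)^a]. At [t = 0] the geometric mean is diag((w/s)^2, 1) and the middle factor is
    diag(s^4/w^2, 1), so all quantities are rational in [s] and [w]. *)
Lemma diag_tangent_Ftilde {R : realType} (a s : R) (w := s `^ (2 * a)) :
  a != 2^-1 -> 1 < s ->
  diag_tangent
    (fun t => Ftilde a (mx2 (s ^+ 2) 0 0 1) (mx2 (s ^+ 2) (1 * t) (1 * t) 1))
    (s ^+ 2)
    ((w ^+ 2 - 1) * (s ^+ 3 + w) * s / (w * (s ^+ 4 - 1) * (w + s))) 1.
Proof.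
move=> ah s1; have s0 : 0 < s by apply: lt_trans s1.
have s_neq0 : s != 0 by rewrite gt_eqF.
have w0 : 0 < w by rewrite powR_gt0.
have w_neq0 : w != 0 by rewrite gt_eqF.
have s20 : 0 < s ^+ 2 by rewrite exprn_gt0.
have s21 : s ^+ 2 != 1 by rewrite gt_eqF // exprn_egt1.
have s41 : s ^+ 4 - 1 != 0 by rewrite subr_eq0 gt_eqF // exprn_egt1.
have ws0 : w + s != 0 by rewrite gt_eqF // addr_gt0.
have powE e : (s ^+ 2) `^ e = (s `^ e) ^+ 2 by rewrite !expr2 powRM // ltW.
(* This is where [a != 2^-1] enters: with [w = s] the geometric mean would be the identity at
   [t = 0], and its eigenvalues would not be distinct. *)
have wsE : w != s.
  rewrite -[X in _ != X](powRr1 (ltW s0)) /w.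
  have -> : s `^ (2 * a) = s `^ (2 * a - 1) * s `^ 1.
    by rewrite -powRD ?subrK // (gt_eqF s0) implybT.
  rewrite powRr1 ?ltW // -subr_eq0 -[X in _ - X]mul1r -mulrBl mulf_neq0 //.
  rewrite subr_eq0 powR_eq1 (gt_eqF s1) /= ltNge (ltW s0) /=.
  by apply: contra ah => /eqP h; apply/eqP; lra.
have Pt := diag_tangent_cst (s ^+ 2) (1 : R).
have St := diag_tangent_affine (s ^+ 2) (1 : R) 1.
have PV := diag_tangentV (lt0r_neq0 s20) (lt0r_neq0 ltr01) Pt.
rewrite invr1 oppr0 mul0r -exprVn in PV.
have sV0 : 0 < s^-1 by rewrite invr_gt0.
have sV1 : s^-1 != 1 by rewrite invr_eq1 gt_eqF.
have zs : s ^+ 2 != s^-1 ^+ 2.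
  rewrite gt_eqF // ltr_pXn2r // ?nnegrE ?ltW //.
  by rewrite (lt_trans _ s1) // invf_lt1.
have G := diag_tangent_gmean a sV0 sV1 s20 zs PV St.
have vE : (s ^+ 2 / s^-1 ^+ 2) `^ a = w ^+ 2.
  have -> : s ^+ 2 / s^-1 ^+ 2 = (s ^+ 2) ^+ 2 by field.
  rewrite [X in X `^ a]expr2 powRM ?ltW // -expr2.
  by rewrite -(powR_mulrn 2 (ltW s0)) -powRrM.
rewrite vE in G.
have offE : s^-1 * ((w ^+ 2 - 1) / (s ^+ 2 / s^-1 ^+ 2 - 1) *
    (1 / s^-1 - (s ^+ 2 / s^-1 + 1) * 0 / (s^-1 * (s^-1 + 1)))) +
    (s^-1 * w ^+ 2 + 1) * 0 / (s^-1 + 1) = (w ^+ 2 - 1) / (s ^+ 4 - 1).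
  by rewrite !mulr0 !mul0r subr0 addr0; field; rewrite s_neq0 s41.
rewrite offE in G.
have G0 : 0 < s^-1 ^+ 2 * w ^+ 2 by rewrite mulr_gt0 ?exprn_gt0.
have G1 : s^-1 ^+ 2 * w ^+ 2 != 1.
  rewrite -exprMn sqrf_eq1 negb_or; apply/andP; split.
    by apply: contra wsE => /eqP h; rewrite -[w](mulVKf s_neq0) h mulr1.
  by rewrite gt_eqF // (lt_trans _ (mulr_gt0 sV0 w0)) // oppr_lt0.
have Gh := diag_tangent_mpow 2^-1 G1 G0 ltr01 G.
have D := diag_tangent_mpow (2 * (1 - a)) s21 s20 ltr01 Pt.
have F := diag_tangent_conj Gh D.
have GhE : (s^-1 ^+ 2 * w ^+ 2) `^ 2^-1 = w / s.
  by rewrite -exprMn powR_half_sqr ?mulr_gt0 // mulrC.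
have DE : (s ^+ 2) `^ (2 * (1 - a)) = s ^+ 4 / w ^+ 2.
  rewrite powE mulrBr mulr1 powRB ?(gt_eqF s0) ?implybT // -/w.
  by rewrite (powR_mulrn 2 (ltW s0)); field.
have wB : w / s - 1 != 0.
  by rewrite subr_eq0; apply: contra wsE => /eqP h; rewrite -[w](divfK s_neq0) h mul1r.
apply: diag_tangent_eq F _ _ _; rewrite ?powR1 ?GhE ?DE.
- by field; rewrite s_neq0 w_neq0.
- field; rewrite ws0 s41 w_neq0 s_neq0 !subr_eq0 s21 andbT /=.
  by rewrite mulN1r subr_eq0 eqrXn2 ?ltW.
- by ring.
Qed.

(** * Counterexamples for exponents other than one half *)

Lemma diag_tangent_mpow_slope {R : realType} (e : R) {M : R -> 'M[R]_2} {x m : R} :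
  x != 1 -> 0 < x -> diag_tangent M x m 1 ->
  diag_tangent (fun t => mpow (M t) e) (x `^ e) ((x `^ e - 1) / (x - 1) * m) 1.
Proof.
move=> x1 x0 Mt; have := diag_tangent_mpow e x1 x0 ltr01 Mt.
by rewrite powR1.
Qed.

Lemma not_near_not_chao {R : realType} {a p q : R} :
  0 < a -> a < 1 -> a != 2^-1 -> 0 < p -> 0 < q ->
  exists A B : 'M[R]_2, [/\ posdef A, posdef B,
    ~ near_le (SGtilde a p A B) (Amean a q A B) &
    ~ chao_le (SGtilde a p A B) (Amean a q A B)].
Proof.
move=> a0 a1 ah p0 q0.
have [s s1 /=] := ratio_neq a0 a1 ah; set w := s `^ (2 * a) => fa.
have s0 : 0 < s by apply: lt_trans s1.
have x0 : 0 < s ^+ 2 by rewrite exprn_gt0.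
have x1 : 1 < s ^+ 2 by rewrite exprn_egt1.
(* [P] and [S t] play the roles of [A^p] and [B^p], so that [p] survives only in the outer power of
   [SGtilde]. *)
pose P := mx2 (s ^+ 2) 0 0 1; pose S t := mx2 (s ^+ 2) (1 * t) (1 * t) 1.
pose A := mpow P p^-1; pose B t := mpow (S t) p^-1.
set f := (w ^+ 2 - 1) * (s ^+ 3 + w) * s / (w * (s ^+ 4 - 1) * (w + s)).
have {}fa : f - a != 0.
  have w0 : 0 < w by rewrite powR_gt0.
  have s41 : 0 < s ^+ 4 - 1 by rewrite subr_gt0 exprn_egt1.
  have d0 : w * (s ^+ 4 - 1) * (w + s) != 0.
    by rewrite gt_eqF // !mulr_gt0 // addr_gt0.
  rewrite subr_eq0; apply: contra fa => /eqP <-.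
  apply/eqP; rewrite /f; field.
  by rewrite (gt_eqF s41) (gt_eqF w0) (gt_eqF (addr_gt0 w0 s0)).
have Ft : diag_tangent (fun t => Ftilde a P (S t)) (s ^+ 2) f 1.
  exact: diag_tangent_Ftilde.
have P0 : posdef P by apply: posdef_mx2 => //; rewrite mulr1 expr0n.
have A0 : posdef A by exact: posdef_mpow.
have St : diag_tangent S (s ^+ 2) 1 1 by exact: diag_tangent_affine.
have S0 := diag_tangent_posdef x0 ltr01 St.
have x_neq1 : s ^+ 2 != 1 by rewrite gt_eqF.
(* [D] is the divided difference of the power [p^-1] at [s^2] and 1: the factor common to the slopes
   of both means. *)
set z := (s ^+ 2) `^ p^-1; set D := (z - 1) / (s ^+ 2 - 1).
have z1 : 1 < z by rewrite powR_gt1 // invr_gt0.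
have z0 : 0 < z by apply: lt_trans z1.
have z_neq1 : z != 1 by rewrite gt_eqF.
have D0 : D != 0 by rewrite mulf_neq0 ?invr_eq0 // subr_eq0.
have At : diag_tangent (fun=> A) z 0 1.
  have := diag_tangent_mpow_slope p^-1 x_neq1 x0 (diag_tangent_cst (s ^+ 2) 1).
  by rewrite mulr0.
have Bt : diag_tangent B z D 1.
  have := diag_tangent_mpow_slope p^-1 x_neq1 x0 St.
  by rewrite mulr1.
pose X t := SGtilde a p A (B t); pose Y t := Amean a q A (B t).
have Xt : diag_tangent X z (D * f) 1.
  apply: diag_tangent_near (diag_tangent_mpow_slope p^-1 x_neq1 x0 Ft).
  move: S0; apply: filterS => t St0.
  by rewrite /X /SGtilde !mpowK // gt_eqF.
have zq1 : z `^ q != 1 by rewrite gt_eqF // powR_gt1.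
have zq0 : 0 < z `^ q by rewrite powR_gt0.
(* The divided differences of the powers [q] and [q^-1] are inverse to each other, so the slope does
   not depend on [q]. *)
have Yt : diag_tangent Y z (D * a) 1.
  have Aq := diag_tangent_mpow_slope q z_neq1 z0 At.
  have Bq := diag_tangent_mpow_slope q z_neq1 z0 Bt.
  have := diag_tangentD (diag_tangentZ (1 - a) Aq) (diag_tangentZ a Bq).
  rewrite -!mulrDl subrK !mul1r => Zt.
  have := diag_tangent_mpow_slope q^-1 zq1 zq0 Zt.
  rewrite -powRrM mulfV ?gt_eqF // powRr1 ?ltW // !mulr0 add0r.
  move=> /diag_tangent_eq; apply=> //.
  by field; rewrite !subr_eq0 zq1 z_neq1.
have near_t : \forall t \near (0 : R)^', ~ near_le (X t) (Y t).
  (* At [t = 0] both means are diag(z, 1), hence [X # Y^-1] is the identity. [diag_tangent_gmean]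
     takes the upper entry as a square, here [z = r^2]. *)
  pose r := Num.sqrt z.
  have r0 : 0 < r by rewrite sqrtr_gt0.
  have rz : r ^+ 2 = z by rewrite sqr_sqrtr // ltW.
  have r1 : r != 1 by apply: contra z_neq1 => /eqP r1; rewrite -rz r1 expr1n.
  have Yi := diag_tangentV (lt0r_neq0 z0) (lt0r_neq0 ltr01) Yt.
  rewrite invr1 in Yi.
  have zr : z^-1 != r ^+ 2.
    by rewrite rz lt_eqF // (lt_trans _ z1) // invf_lt1.
  have zi0 : 0 < z^-1 by rewrite invr_gt0.
  rewrite -rz in Xt.
  have Gt := diag_tangent_gmean 2^-1 r0 r1 zi0 zr Xt Yi.
  have vE : (z^-1 / r ^+ 2) `^ 2^-1 = z^-1.
    by rewrite rz -expr2 powR_half_sqr.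
  rewrite vE -rz in Gt.
  have r_neq0 : r != 0 by rewrite gt_eqF.
  have rD : r + 1 != 0 by rewrite gt_eqF // addr_gt0.
  have r2D : r ^+ 2 + 1 != 0 by rewrite gt_eqF // addr_gt0 // exprn_gt0.
  have r2B : r ^+ 2 - 1 != 0 by rewrite rz subr_eq0.
  have It := diag_tangent_cst (1 : R) 1.
  have r4B : 1 - r ^+ 4 != 0.
    rewrite (_ : 1 - r ^+ 4 = - ((r ^+ 2 - 1) * (r ^+ 2 + 1))); last by ring.
    by rewrite oppr_eq0 mulf_neq0.
  have offE : 0 - (r * (((r ^+ 2)^-1 - 1) / ((r ^+ 2)^-1 / r ^+ 2 - 1) *
      (- (D * a) / (r ^+ 2 * 1) / r - ((r ^+ 2)^-1 / r + 1) * (D * f) / (r * (r + 1)))) +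
      (r * (r ^+ 2)^-1 + 1) * (D * f) / (r + 1)) = - (D * (f - a) / (r ^+ 2 + 1)).
    field; rewrite r2D rD r_neq0 /=.
    by rewrite (_ : 1 + _ = 1 - r ^+ 4) //; ring.
  have := diag_tangent_eq (diag_tangentB It Gt) _ offE _.
  rewrite mulfV ?expf_neq0 // subrr => /(_ _ _ erefl erefl).
  have off0 : - (D * (f - a) / (r ^+ 2 + 1)) != 0.
    by rewrite oppr_eq0 mulf_neq0 ?invr_eq0 // mulf_neq0.
  move=> /(diag_tangent_not_psd off0).
  by apply: filterS => t; rewrite -(scalar_mx2 1).
have chao_t : \forall t \near (0 : R)^', ~ chao_le (X t) (Y t).
  have LX := diag_tangent_mlog z_neq1 z0 ltr01 Xt.
  have LY := diag_tangent_mlog z_neq1 z0 ltr01 Yt.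
  have := diag_tangent_eq (diag_tangentB LY LX) (subrr _) erefl (subrr _).
  apply: diag_tangent_not_psd.
  (* The off-diagonal slope of the difference of logarithms is [ln z / (z - 1) * (D * (a - f))]. *)
  rewrite -mulrBr -mulrBr ln1 subr0 !mulf_neq0 ?invr_eq0 ?subr_eq0 //.
    by rewrite gt_eqF // ln_gt0.
  by rewrite eq_sym -subr_eq0.
have [t [[S0t nt] ct]] : exists t,
    (posdef (S t) /\ ~ near_le (X t) (Y t)) /\ ~ chao_le (X t) (Y t).
  apply: (@filter_ex _ (0 : R)^').
  apply: filterI; last exact: chao_t.
  by apply: filterI; [exact: nbhs_dnbhs S0 | exact: near_t].
exists A, (B t); split=> //; exact: posdef_mpow.
Qed.

(** * The chaotic order for a = 1/2 *)

Lemma invr2D {R : realType} : 2^-1 + 2^-1 = 1 :> R.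
Proof. by field. Qed.

Lemma quadD {R : realType} {n} (A B : 'M[R]_n) (v : 'rV[R]_n) :
  (v *m (A + B) *m v^T) 0 0 = (v *m A *m v^T) 0 0 + (v *m B *m v^T) 0 0.
Proof. by rewrite mulmxDr mulmxDl mxE. Qed.

Lemma quadZ {R : realType} {n} k (A : 'M[R]_n) (v : 'rV[R]_n) :
  (v *m (k *: A) *m v^T) 0 0 = k * (v *m A *m v^T) 0 0.
Proof. by rewrite -scalemxAr -scalemxAl mxE. Qed.

Lemma psdD {R : realType} {n} {A B : 'M[R]_n} : psd A -> psd B -> psd (A + B).
Proof.
move=> [At A0] [Bt B0]; split=> [|v]; first by rewrite linearD /= At Bt.
by rewrite quadD addr_ge0.
Qed.

Lemma psdZ {R : realType} {n} {k} {A : 'M[R]_n} : 0 <= k -> psd A -> psd (k *: A).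
Proof.
move=> k0 [At A0]; split=> [|v]; first by rewrite linearZ /= At.
by rewrite quadZ mulr_ge0.
Qed.

Lemma posdefD {R : realType} {n} (A B : 'M[R]_n) :
  posdef A -> posdef B -> posdef (A + B).
Proof.
move=> [At A0] [Bt B0]; split=> [|v v0]; first by rewrite linearD /= At Bt.
by rewrite quadD addr_gt0 ?A0 ?B0.
Qed.

Lemma posdefZ {R : realType} {n} {k} {A : 'M[R]_n} :
  0 < k -> posdef A -> posdef (k *: A).
Proof.
move=> k0 [At A0]; split=> [|v v0]; first by rewrite linearZ /= At.
by rewrite quadZ mulr_gt0 ?A0.
Qed.

Lemma posdef_conj {R : realType} {n} {T A : 'M[R]_n} :
  posdef T -> posdef A -> posdef (T *m A *m T).
Proof.
move=> [Tt T0] [At A0]; split=> [|v v0].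
  by rewrite !trmx_mul Tt At mulmxA.
rewrite (_ : v *m _ *m _ = v *m T *m A *m (v *m T)^T); last first.
  by rewrite trmx_mul Tt !mulmxA.
(* [v *m T] is nonzero because [v *m T *m v^T] is positive. *)
apply: A0; apply: contraTneq (T0 v v0) => ->.
by rewrite mul0mx mxE ltxx.
Qed.

Lemma loewner_le_trans {R : realType} {n} {A B C : 'M[R]_n} :
  loewner_le A B -> loewner_le B C -> loewner_le A C.
Proof. by move=> AB BC; have := psdD BC AB; rewrite addrA subrK. Qed.

Lemma loewner_le_00 {R : realType} {A B : 'M[R]_2} :
  loewner_le A B -> A 0 0 <= B 0 0.
Proof.
move=> [_ /(_ (delta_mx 0 0))]; rewrite -rowE mxE sum_I2 !mxE /=.
by rewrite mulr1 mulr0 addr0 subr_ge0.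
Qed.

(* If Q - P had an eigenvalue l < 0 with eigenvector v, then
   v (Q^2 - P^2) v^T = l (v P v^T + v Q v^T) < 0. *)
Lemma sqr_loewner_le {R : realType} (P Q : 'M[R]_2) : posdef P -> posdef Q ->
  loewner_le (P *m P) (Q *m Q) -> loewner_le P Q.
Proof.
move=> [Pt P0] [Qt Q0] [_ PQ].
have Dt : (Q - P)^T = Q - P by rewrite linearB /= Pt Qt.
have [U [d DUd]] := spec_decomp2 _ Dt.
apply/(psd_specP DUd) => i; rewrite leNgt; apply/negP => di.
set v : 'rV[R]_2 := delta_mx 0 i *m U^T.
have v0 : v != 0 by exact: eigen_neq0 DUd.
have vQ : v *m Q = v *m P + d 0 i *: v.
  apply/eqP; rewrite addrC -subr_eq -mulmxBr; apply/eqP.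
  case: (DUd) => _ {1}->; rewrite /v !mulmxA -(mulmxA _ U^T) (spec_decompV DUd) mulmx1.
  by rewrite -(rowE i (diag_mx d)) row_diag_mx -scalemxAl.
have Qv : Q *m v^T = P *m v^T + d 0 i *: v^T.
  by rewrite -{1}Qt -trmx_mul vQ linearD linearZ /= trmx_mul Pt.
have := PQ v; rewrite leNgt => /negP; apply.
have vQQ : v *m Q *m Q *m v^T =
    v *m P *m P *m v^T + d 0 i *: (v *m P *m v^T) + d 0 i *: (v *m Q *m v^T).
  rewrite -(mulmxA (v *m Q)) Qv mulmxDr -scalemxAr mulmxA; congr (_ + _).
  by rewrite vQ !mulmxDl -!scalemxAl.
have -> : v *m (Q *m Q - P *m P) *m v^T = d 0 i *: (v *m P *m v^T + v *m Q *m v^T).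
  rewrite mulmxBr mulmxBl !mulmxA vQQ scalerDr addrAC; congr (_ + _).
  by rewrite addrAC subrr add0r.
by rewrite mxE nmulr_rlt0 // mxE addr_gt0 ?P0 ?Q0.
Qed.

Lemma mpow_half_le {R : realType} (A B : 'M[R]_2) : posdef A -> posdef B ->
  loewner_le A B -> loewner_le (mpow A 2^-1) (mpow B 2^-1).
Proof.
move=> A0 B0 AB; apply: sqr_loewner_le; try exact: posdef_mpow.
by rewrite !mpowD // invr2D !mpow1.
Qed.

Lemma mpow_dyadic_le {R : realType} {A B : 'M[R]_2} (k : nat) :
  posdef A -> posdef B -> loewner_le A B ->
  loewner_le (mpow A (2^-1 ^+ k)) (mpow B (2^-1 ^+ k)).
Proof.
move=> A0 B0 AB; elim: k => [|k IH]; first by rewrite !mpow1.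
rewrite exprSr -!mpow_mpow //.
by apply: mpow_half_le => //; exact: posdef_mpow.
Qed.

(* Replaces operator monotonicity of the logarithm: that of dyadic roots follows
   from iterating square roots. *)
Lemma ln_le_powR {R : realType} (x r : R) : 0 < x -> 0 < r ->
  ln x <= r^-1 * x `^ r + - r^-1.
Proof.
move=> x0 r0.
rewrite (_ : _ + _ = (x `^ r - 1) / r); last by field; rewrite gt_eqF.
rewrite ler_pdivlMr // mulrC -ln_powR.
have : -1 < x `^ r - 1 by rewrite ltrBrDr addNr powR_gt0.
by move/le_ln1Dx; rewrite [1 + _]addrC subrK.
Qed.

Lemma mlog_le_mpow {R : realType} {A : 'M[R]_2} {r : R} : posdef A -> 0 < r ->
  loewner_le (mlog A) (r^-1 *: mpow A r + (- r^-1)%:M).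
Proof.
move=> /posdef_spec[U [d [AUd d0]]] r0.
rewrite -(mfun_affine _ _ _ AUd).
by apply: (mfun_le _ _ AUd) => i; rewrite ln_le_powR.
Qed.

(** Comparison with a scalar matrix only bounds the eigenvalues, so it passes to every power
    [t >= 0], also beyond 1 where powers are not operator monotone. *)
Lemma mpow_le_scalar {R : realType} (A : 'M[R]_2) (c t : R) :
  posdef A -> 0 < c -> 0 <= t -> loewner_le A c%:M -> loewner_le (mpow A t) (c `^ t)%:M.
Proof.
move=> /posdef_spec[U [d [AUd d0]]] c0 t0 Ac.
have Ad := spec_decomp_affine (-1) c AUd.
have dc i : d 0 i <= c.
  have : psd (-1 *: A + c%:M) by rewrite scaleN1r addrC.
  by move/(psd_specP Ad)/(_ i); rewrite mxE mulN1r addrC subr_ge0.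
have -> : (c `^ t)%:M = mfun (fun x => 0 * id x + c `^ t) A.
  by rewrite (mfun_affine _ _ _ AUd) scale0r add0r.
apply: (mfun_le _ _ AUd) => i; rewrite mul0r add0r.
by rewrite ge0_ler_powR ?nnegrE // ltW.
Qed.

Lemma scalar_le_mpow {R : realType} (A : 'M[R]_2) (c t : R) :
  posdef A -> 0 < c -> 0 <= t -> loewner_le c%:M A -> loewner_le (c `^ t)%:M (mpow A t).
Proof.
move=> /posdef_spec[U [d [AUd d0]]] c0 t0 Ac.
have Ad := spec_decomp_affine 1 (- c) AUd.
have dc i : c <= d 0 i.
  have : psd (1 *: A + (- c)%:M) by rewrite scale1r raddfN.
  by move/(psd_specP Ad)/(_ i); rewrite mxE mul1r subr_ge0.
have -> : (c `^ t)%:M = mfun (fun x => 0 * id x + c `^ t) A.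
  by rewrite (mfun_affine _ _ _ AUd) scale0r add0r.
apply: (mfun_le _ _ AUd) => i; rewrite mul0r add0r.
by rewrite ge0_ler_powR ?nnegrE // ltW.
Qed.

Lemma mlog_mpow {R : realType} (A : 'M[R]_2) (s : R) : posdef A ->
  mlog (mpow A s) = s *: mlog A.
Proof.
move=> /posdef_spec[U [d [AUd d0]]]; rewrite /mlog /mpow (mfun_comp _ _ AUd).
rewrite -[RHS]addr0 -(raddf0 (@scalar_mx R 2)) -(mfun_affine _ _ _ AUd).
by apply: (eq_mfun _ _ AUd) => i /=; rewrite ln_powR addr0.
Qed.

(** * An explicit pair of matrices for exponent one half *)

(** With [Q] the square root of [C], [Q E^2 C E^2 Q = (Q E^2 Q)^2], so the geometric mean of [C^-1]
    and [E^2 C E^2] is [E^2]. Its square root is [E], and the middle factor is [C^1]. *)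
Lemma Ftilde_half {R : realType} (C E : 'M[R]_2) : posdef C -> posdef E ->
  Ftilde 2^-1 C (E *m E *m C *m (E *m E)) = E *m C *m E.
Proof.
move=> C0 E0; set Q := mpow C 2^-1.
have Q0 : posdef Q by exact: posdef_mpow.
have QQ : Q *m Q = C by rewrite mpowD // invr2D mpow1.
have EE0 : posdef (E *m E).
  have := posdef_conj E0 (posdef_mpow _ 0 E0).
  by rewrite mpow0 // mulmx1.
have Gm : gmean 2^-1 (invmx C) (E *m E *m C *m (E *m E)) = E *m E.
  rewrite /gmean !invmx_mpow // opprK -/Q.
  have -> : Q *m (E *m E *m C *m (E *m E)) *m Q =
            (Q *m (E *m E) *m Q) *m (Q *m (E *m E) *m Q).
    by rewrite -QQ !mulmxA.
  rewrite mpow_sqr; last exact: posdef_conj.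
  have QV : mpow C (- 2^-1) *m Q = 1%:M by rewrite mpowD // addNr mpow0.
  by rewrite !mulmxA QV mul1mx -mulmxA (mulmx1C QV) mulmx1.
rewrite /Ftilde Gm mpow_sqr // (_ : 2 * (1 - 2^-1) = 1) ?mpow1 //.
by field.
Qed.

(* Eigenvalues 1/4 and 64 = (1/4)^-3, with weights 4/5 and 1/5 on the first basis
   vector, so that (log C)_00 = (-4/5 + 3/5) ln 4 < 0. *)
Definition pinchedC {R : realType} : 'M[R]_2 := mx2 13 (51 / 2) (51 / 2) (205 / 4).

(* The lower right entry is the one making E C E diagonal. *)
Definition squeezeE {R : realType} : 'M[R]_2 :=
  mx2 (1 / 3) (- (1 / 36)) (- (1 / 36)) (29 / 2038).

Lemma posdef_pinched {R : realType} : posdef (@pinchedC R).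
Proof. by apply: posdef_mx2; lra. Qed.

Lemma posdef_squeeze {R : realType} : posdef (@squeezeE R).
Proof. by apply: posdef_mx2; lra. Qed.

Lemma ECE_diag {R : realType} : exists k l : R,
  [/\ @squeezeE R *m pinchedC *m squeezeE = mx2 k 0 0 l,
      1 <= k <= 11 / 10 & 0 <= l <= 1 / 1000].
Proof.
exists (5245 / 5184), (20980 / 9171 / 9171); split; try by apply/andP; split; lra.
by rewrite !mul_mx2; apply: mx2_eq; lra.
Qed.

(** The scalar is the smaller eigenvalue, so the determinant of the difference is exactly 0. *)
Lemma quarter_le_pinched {R : realType} : loewner_le (4^-1)%:M (@pinchedC R).
Proof.
rewrite /loewner_le scalar_mx2 opp_mx2 add_mx2 subr0.
by apply: psd_mx2; lra.
Qed.

Lemma EECEE_le_quarter {R : realType} :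
  loewner_le (@squeezeE R *m squeezeE *m pinchedC *m (squeezeE *m squeezeE)) (4^-1)%:M.
Proof.
have -> : @squeezeE R *m squeezeE *m pinchedC *m (squeezeE *m squeezeE) =
    squeezeE *m (squeezeE *m pinchedC *m squeezeE) *m squeezeE.
  by rewrite !mulmxA.
have [k [l [-> /andP[k1 k2] /andP[l0 l1]]]] := @ECE_diag R; rewrite /squeezeE.
(* From here only bounds on [k], [l] and [y] are used; [ly0], [ly1] and [lyy] bound the nonlinear
   monomials for [lra]. *)
have [y [y0 y1 ->]] : exists y : R, [/\ 0 <= y, y <= 1 / 50 & 29 / 2038 = y].
  by exists (29 / 2038); split=> //; lra.
have ly0 : 0 <= l * y by rewrite mulr_ge0.
have ly1 : l * y <= 1 / 1000 * 1 by rewrite ler_pM //; lra.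
have lyy : l * y * y <= 1 / 1000 * 1 * 1 by rewrite ler_pM //; lra.
rewrite /loewner_le scalar_mx2 !mul_mx2 opp_mx2 add_mx2.
set a := (X in mx2 X _ _ _); set b := (X in mx2 _ X _ _).
set b' := (X in mx2 _ _ X _); set c := (X in mx2 _ _ _ X).
have -> : b' = b by rewrite /b /b'; ring.
(* Diagonal entries at least 1/10 and an off-diagonal entry of size at most 1/10 give
   [b^2 <= a c]. *)
have a1 : 1 / 10 <= a by rewrite /a; lra.
have c1 : 1 / 10 <= c by rewrite /c; lra.
have b1 : `|b| <= 1 / 10 by rewrite ler_norml /b; apply/andP; split; lra.
apply: psd_mx2; first lra.
apply: (@le_trans _ _ ((1 / 10) * (1 / 10))); last by rewrite ler_pM //; lra.
by rewrite -real_normK ?num_real // expr2 ler_pM.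
Qed.

Lemma pinched_pow_00 {R : realType} (s : R) :
  mpow pinchedC s 0 0 = (4 / 4 `^ s + (4 `^ s) ^+ 3) / 5.
Proof.
(* 255/4 is the gap [64 - 1/4] between the eigenvalues. *)
have r0 : 255 / 4 != 0 :> R by rewrite gt_eqF //; lra.
have rr : (255 / 4) ^+ 2 = (13 - 205 / 4) ^+ 2 + 4 * (51 / 2) ^+ 2 :> R by field.
rewrite /mpow /pinchedC (mfun_mx2 _ _ _ _ _ r0 rr) !mxE /=.
have -> : (13 + 205 / 4 + 255 / 4) / 2 = 4 ^+ 3 :> R by field.
have -> : (13 + 205 / 4 - 255 / 4) / 2 = 4^-1 :> R by field.
have p4 : 4 `^ s != 0 :> R by rewrite gt_eqF // powR_gt0.
have -> : 4^-1 `^ s = (4 `^ s)^-1 :> R.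
  by rewrite -powR_inv1 // -powRrM mulN1r powRN.
have -> : (4 ^+ 3) `^ s = (4 `^ s) ^+ 3 :> R.
  by rewrite -(powR_mulrn 3 (powR_ge0 4 s)) -(powR_mulrn 3 (ler0n R 4)) -!powRrM mulrC.
by field.
Qed.

(** For [y = 4^s] the entry is below 1 exactly when [(y - 1)(4 - y - y^2 - y^3) > 0], which holds
    for [1 < y <= 11/10], that is, for all small positive [s]. *)
Lemma pinched_dyadic_00 {R : realType} {u : R} : 0 < u ->
  exists k : nat, mpow (mpow pinchedC u) (2^-1 ^+ k) 0 0 < 1.
Proof.
(* [s <= l] means [4^s <= 11/10]; the exponent [k] comes from the Archimedean property and
   [k < 2^k]. *)
move=> u0; pose l : R := ln (11 / 10) / ln 4.
have ln4 : 0 < ln 4 :> R by rewrite ln_gt0 //; lra.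
have l0 : 0 < l by rewrite divr_gt0 // ln_gt0 //; lra.
have [k uk] : exists k : nat, u * 2^-1 ^+ k <= l.
  exists (Num.bound (u / l)).
  rewrite exprVn ler_pdivrMr ?exprn_gt0 // mulrC -ler_pdivrMr //.
  apply: le_trans (ltW (archi_boundP _)) _; first by rewrite ltW // divr_gt0.
  by rewrite -natrX ler_nat ltnW // ltn_expl.
exists k; rewrite mpow_mpow; last exact: posdef_pinched.
set s := u * _; rewrite pinched_pow_00.
have s0 : 0 < s by rewrite mulr_gt0 // exprn_gt0 // invr_gt0.
set y := 4 `^ s.
have y1 : 1 < y by rewrite powR_gt1 //; lra.
have y11 : y <= 11 / 10.
  rewrite -ler_ln ?posrE ?powR_gt0 //; last lra.
  by rewrite ln_powR -ler_pdivlMr.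
have y0 : 0 < y by lra.
rewrite ltr_pdivrMr // mul1r -ltrBrDr ltr_pdivrMr // -subr_gt0.
have -> : (5 - y ^+ 3) * y - 4 = (y - 1) * (4 - y - y ^+ 2 - y ^+ 3) by ring.
rewrite mulr_gt0 ?subr_gt0 //.
have h2 : y ^+ 2 <= (11 / 10) ^+ 2 by rewrite lerXn2r // nnegrE; lra.
have h3 : y ^+ 3 <= (11 / 10) ^+ 3 by rewrite lerXn2r // nnegrE; lra.
lra.
Qed.

Lemma not_chao_half {R : realType} (p q : R) : 0 < p -> 0 < q ->
  exists A B : 'M[R]_2, posdef A /\ posdef B /\
    ~ chao_le (SGtilde 2^-1 p A B) (Amean 2^-1 q A B).
Proof.
move=> p0 q0.
have C0 := @posdef_pinched R; have E0 := @posdef_squeeze R.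
set S : 'M[R]_2 := squeezeE *m squeezeE *m pinchedC *m (squeezeE *m squeezeE).
have S0 : posdef S.
  rewrite /S (_ : _ *m _ = squeezeE *m (squeezeE *m pinchedC *m squeezeE) *m squeezeE);
    last by rewrite !mulmxA.
  by apply: posdef_conj => //; exact: posdef_conj.
exists (mpow pinchedC p^-1), (mpow S p^-1); do 2 (split; first exact: posdef_mpow).
set u := p^-1 * q; have u0 : 0 < u by rewrite mulr_gt0 ?invr_gt0.
rewrite /chao_le /SGtilde /Amean !mpowK ?gt_eqF // Ftilde_half // !mpow_mpow // -/u.
set Z := _ *: mpow pinchedC u + _.
have h0 : 0 < 2^-1 :> R by rewrite invr_gt0.
have h1 : 1 - 2^-1 = 2^-1 :> R by field.
have Z0 : posdef Z by apply: posdefD; apply: posdefZ; rewrite ?h1 //; exact: posdef_mpow.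
have K0 : posdef (squeezeE *m pinchedC *m squeezeE : 'M[R]_2) by exact: posdef_conj.
(* The Loewner order is refuted on the upper left entries: nonnegative for log(E C E), negative for
   log [Z]. *)
rewrite !mlog_mpow // => /loewner_le_00; rewrite !mxE; apply/negP; rewrite -ltNge.
have K_ge0 : 0 <= mlog (squeezeE *m pinchedC *m squeezeE) 0 0 :> R.
  have [k [l [-> /andP[k1 _] /andP[l0 l1]]]] := @ECE_diag R.
  have kl : k - l != 0 by rewrite gt_eqF // subr_gt0; lra.
  have rr : (k - l) ^+ 2 = (k - l) ^+ 2 + 4 * 0 ^+ 2 by rewrite expr0n mulr0 addr0.
  rewrite /mlog (mfun_mx2 _ _ _ _ _ kl rr) mxE /=.
  have -> : (k + l + (k - l)) / 2 = k by field.
  have -> : (k + l - (k - l)) / 2 = l by field.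
  by rewrite [leRHS](_ : _ = ln k) ?ln_ge0 //; field.
(* The scalar 1/4 separates [S] from [pinchedC], so [S^u <= C^u] for [u = q / p] of any size, and
   the average [Z] is at most [C^u]. *)
have ZW : loewner_le Z (mpow pinchedC u).
  have SC : loewner_le (mpow S u) (mpow pinchedC u).
    apply: (@loewner_le_trans _ _ _ (4^-1 `^ u)%:M).
      by apply: mpow_le_scalar; rewrite ?ltW ?invr_gt0 //; exact: EECEE_le_quarter.
    by apply: scalar_le_mpow; rewrite ?ltW ?invr_gt0 //; exact: quarter_le_pinched.
  have := psdZ (ltW h0) SC.
  have CE : mpow pinchedC u =
      2^-1 *: mpow pinchedC u + 2^-1 *: mpow pinchedC u :> 'M[R]_2.
    by rewrite -scalerDl invr2D scale1r.
  rewrite scalerBr /loewner_le /Z h1 [X in _ -> psd (X - _)]CE.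
  by rewrite opprD addrACA subrr add0r.
(* With [r = 2^-k], the upper left entry of [Z^r] is at most that of [C^(u r)], hence below 1, and
   log [Z] is at most [(Z^r - 1) / r]. *)
have [k Ck] := pinched_dyadic_00 u0.
have r0 : 0 < 2^-1 ^+ k :> R by rewrite exprn_gt0.
have Zk := le_lt_trans (loewner_le_00 (mpow_dyadic_le k Z0 (posdef_mpow _ u C0) ZW)) Ck.
have := loewner_le_00 (mlog_le_mpow Z0 r0).
rewrite !mxE /= => Zlog.
have Z_lt0 : mlog Z 0 0 < 0.
  apply: le_lt_trans Zlog _; rewrite mulr1n -[X in _ - X]mulr1 -mulrBr.
  by rewrite pmulr_rlt0 ?invr_gt0 // subr_lt0.
apply: (@lt_le_trans _ _ 0); first by rewrite pmulr_rlt0 ?invr_gt0.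
by rewrite mulr_ge0 // invr_ge0 ltW.
Qed.

Theorem theorem4p32 (R : realType) :
  (forall a p q : R, 0 < a -> a < 1 -> a != 2^-1 -> 0 < p -> 0 < q ->
     exists A B : 'M[R]_2, posdef A /\ posdef B /\
       ~ near_le (SGtilde a p A B) (Amean a q A B)) /\
  (forall a p q : R, 0 < a -> a < 1 -> 0 < p -> 0 < q ->
     exists A B : 'M[R]_2, posdef A /\ posdef B /\
       ~ chao_le (SGtilde a p A B) (Amean a q A B)).
Proof.
split=> a p q a0 a1.
  move=> ah p0 q0; have [A [B [A0 B0 nAB _]]] := not_near_not_chao a0 a1 ah p0 q0.
  by exists A, B.
move=> p0 q0; have [->|ah] := eqVneq a 2^-1; first exact: not_chao_half.
have [A [B [A0 B0 _ nAB]]] := not_near_not_chao a0 a1 ah p0 q0.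
by exists A, B.
Qed.
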